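(* When $n\ge 2$, we have $A_{n,1}(t)=\mathrm{AExc}_{n,1}(t)=A_{n-1}(t)$. When $n\ge2$ and $2\le j\le n$, we have $A_{n,j}(t)=\mathrm{AExc}_{n,n+2-j}(t)$. Thus, for a fixed $n\ge 2$, the two families of polynomials $(A_{n,i}(t))_{1\le i\le n}$ and $(\mathrm{AExc}_{n,i}(t))_{1\le i\le n}$ are the same up to a permutation of the index $i$.
   Context: $\mathfrak{S}_n$ is the set of permutations $\pi=\pi_1\cdots\pi_n$ of $[n]=\{1,\dots,n\}$. For $\pi\in\mathfrak{S}_n$, $\mathrm{des}(\pi)=|\{i\in[n-1]:\pi_i>\pi_{i+1}\}|$ and $\mathrm{exc}(\pi)=|\{i\in[n]:\pi_i>i\}|$. Set $A_n(t)=\sum_{\pi\in\mathfrak{S}_n}t^{\mathrm{des}(\pi)}$. For $1\le j\le n$ let $\mathfrak{S}_{n,j}=\{\pi\in\mathfrak{S}_n:\pi_1=j\}$, $A_{n,j}(t)=\sum_{\pi\in\mathfrak{S}_{n,j}}t^{\mathrm{des}(\pi)}$ and $\mathrm{AExc}_{n,j}(t)=\sum_{\pi\in\mathfrak{S}_{n,j}}t^{\mathrm{exc}(\pi)}$. *)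

(* Defs.v *)
From mathcomp Require Import all_boot all_order all_fingroup all_algebra.
Set Implicit Arguments.
Unset Strict Implicit.
Unset Printing Implicit Defensive.
Import GRing.Theory.
Local Open Scope ring_scope.

(* Permutations of [n] = {1, ..., n} are elements of 'S_n, which acts on
   {0, ..., n - 1}.  All indices and values below are shifted to be 1-based:
   [letter s i] is pi_i, meaningful for 1 <= i <= n only. *)
Definition one_line (n : nat) (s : 'S_n) : seq nat :=
  [seq (s i).+1 | i <- enum 'I_n].

Definition letter (n : nat) (s : 'S_n) (i : nat) : nat :=
  nth 0%N (one_line s) i.-1.

Lemma letterE (n : nat) (s : 'S_n) (i : 'I_n) : letter s i.+1 = (s i).+1.
Proof.
by rewrite /letter /one_line (nth_map i) ?size_enum_ord //= nth_ord_enum.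
Qed.

Definition des (n : nat) (s : 'S_n) : nat :=
  count (fun i => letter s i > letter s i.+1)%N (iota 1 n.-1).

Definition exc (n : nat) (s : 'S_n) : nat :=
  count (fun i => letter s i > i)%N (iota 1 n).

Definition perms_starting (n j : nat) : {set 'S_n} :=
  [set s : 'S_n | letter s 1 == j].

Definition A (n : nat) : {poly int} := \sum_(s : 'S_n) 'X^(des s).

Definition A_first (n j : nat) : {poly int} :=
  \sum_(s in perms_starting n j) 'X^(des s).

Definition AExc_first (n j : nat) : {poly int} :=
  \sum_(s in perms_starting n j) 'X^(exc s).

(* Main.v *)
(** Write a(n,j) and e(n,j) for the two polynomials.  Deleting the first letter
    gives a(n,j+1) - a(n,j) = (t-1) a(n-1,j), with a(n,1) = A(n-1) and
    a(n,n) = t A(n-1).  For excedances, the permutations that start with j and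
    with j+1 (j >= 2) have the same excedances once their first letter is
    deleted, except when j is mapped to j+1; contracting that arrow gives
    e(n,j) - e(n,j+1) = (t-1) e(n-1,j), while e(n,2) = t e(n,1) and e(n,1) is the
    excedance polynomial of size n-1.  These are the same recurrences after
    j |-> n+2-j, and induction on n concludes, the equality of the total
    descent and excedance polynomials being carried along. *)

Require Import Defs.
From mathcomp Require Import all_boot all_order all_fingroup all_algebra.
From mathcomp Require Import zify ring.

Set Implicit Arguments.
Unset Strict Implicit.
Unset Printing Implicit Defensive.
Import GRing.Theory.
Local Open Scope ring_scope.

Lemma lift_perm_inj (n : nat) (i j : 'I_n.+1) : injective (@lift_perm n i j).
Proof.
move=> s t est; apply/permP=> k; apply: (@lift_inj _ j).
by rewrite -!(lift_perm_lift i j) est.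
Qed.

Lemma lift_perm_surj (n : nat) (i j : 'I_n.+1) (s : 'S_n.+1) :
  s i = j -> exists t, s = lift_perm i j t.
Proof.
(* The default [k] is never taken, since [s] sends only [i] to [j]. *)
move=> sij; pose f k := odflt k (unlift j (s (lift i k))).
have fE k : lift j (f k) = s (lift i k).
  have nj : j != s (lift i k) by rewrite -sij (inj_eq perm_inj) neq_lift.
  by rewrite /f; case: (unlift_some nj) => l -> ->.
have f_inj : injective f.
  by move=> k l /(congr1 (lift j)); rewrite !fE => /perm_inj/lift_inj.
exists (perm f_inj); apply/permP=> k.
case: (unliftP i k) => [l|] ->; last by rewrite lift_perm_id.
by rewrite lift_perm_lift permE fE.
Qed.

Lemma sum_perm_lift (V : nmodType) (n : nat) (i j : 'I_n.+1) (F : 'S_n.+1 -> V) :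
  \sum_(s : 'S_n.+1 | s i == j) F s = \sum_(t : 'S_n) F (lift_perm i j t).
Proof.
transitivity (\sum_(s in [set lift_perm i j t | t in [set: 'S_n]]) F s).
  apply: eq_bigl => s; apply/eqP/imsetP => [/lift_perm_surj[t ->]|[t _ ->]].
    by exists t; rewrite ?inE.
  by rewrite lift_perm_id.
rewrite big_imset /=; last by move=> s t _ _ /lift_perm_inj.
by apply: eq_bigl => s; rewrite inE.
Qed.

Lemma letter1E (n : nat) (s : 'S_n.+1) : letter s 1 = (s ord0).+1.
Proof. exact: (letterE s ord0). Qed.

Lemma sum_perms_starting (V : nmodType) (n : nat) (j : 'I_n.+1)
    (F : 'S_n.+1 -> V) :
  \sum_(s in perms_starting n.+1 j.+1) F s
    = \sum_(t : 'S_n) F (lift_perm ord0 j t).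
Proof.
by rewrite -sum_perm_lift; apply: eq_bigl => s; rewrite inE letter1E eqSS.
Qed.

Lemma sum_by_first_letter (V : nmodType) (n : nat) (F : 'S_n.+1 -> V) :
  \sum_s F s = \sum_(j < n.+1) \sum_(s in perms_starting n.+1 j.+1) F s.
Proof.
rewrite (partition_big (fun s : 'S_n.+1 => s ord0) predT) //=.
by apply: eq_bigr => j _; apply: eq_bigl => s; rewrite inE letter1E eqSS.
Qed.

(** Skipping the value [j] keeps the relative order of the other letters, so only the front position
    can bring a new descent. *)
Lemma des_lift_perm (n : nat) (j : 'I_n.+2) (s : 'S_n.+1) :
  des (lift_perm ord0 j s) = ((s ord0 < j) + des s)%N.
Proof.
have letter_lift i : (i < n.+1)%N ->
    letter (lift_perm ord0 j s) i.+2 = (bump j (letter s i.+1).-1).+1.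
  move=> lt_in; have := letterE (lift_perm ord0 j s) (lift ord0 (Ordinal lt_in)).
  by rewrite lift_perm_lift => ->; rewrite (letterE s (Ordinal lt_in)).
rewrite /des /=; congr (_ + _)%N.
  by rewrite letter_lift // !letter1E lift_perm_id /bump /=; lia.
rewrite -[2%N]/(1 + 1)%N iotaDl count_map; apply: eq_in_count => i.
rewrite mem_iota => /andP[i_gt0 lt_in] /=.
case: i i_gt0 lt_in => // i _ lt_in; rewrite !add1n !letter_lift; try lia.
have lt_i : (i < n.+1)%N by lia.
have lt_i1 : (i.+1 < n.+1)%N by lia.
rewrite (letterE s (Ordinal lt_i)) (letterE s (Ordinal lt_i1)) /bump /=; lia.
Qed.

Lemma A_firstE (n : nat) (j : 'I_n.+2) :
  A_first n.+2 j.+1 = \sum_(s : 'S_n.+1) 'X^((s ord0 < j) + des s).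
Proof.
by rewrite /A_first sum_perms_starting; apply: eq_bigr => s _;
  rewrite des_lift_perm.
Qed.

Lemma A_first1 (n : nat) : A_first n.+2 1 = A n.+1.
Proof. by rewrite (A_firstE ord0). Qed.

Lemma A_first_max (n : nat) : A_first n.+2 n.+2 = 'X * A n.+1.
Proof.
rewrite (A_firstE ord_max) /A mulr_sumr; apply: eq_bigr => s _.
by rewrite ltn_ord exprS.
Qed.

Lemma A_first_step (n j : nat) : (j <= n)%N ->
  A_first n.+2 j.+2 - A_first n.+2 j.+1 = ('X - 1) * A_first n.+1 j.+1.
Proof.
rewrite -ltnS => lt_jn; have lt_jn2 : (j < n.+2)%N by lia.
rewrite (A_firstE (Ordinal lt_jn2)) (@A_firstE n (Ordinal (_ : j.+1 < n.+2)%N)).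
rewrite /= /A_first -sumrB mulr_sumr [RHS]big_mkcond; apply: eq_bigr => s _.
(* Front descents for [j] and [j.+1] differ only when [s ord0 = j]. *)
rewrite inE letter1E eqSS ltnS leq_eqVlt; case: eqP => [->|_] /=.
  by rewrite ltnn !exprD expr1 expr0; ring.
by rewrite subrr.
Qed.

Lemma excE (n : nat) (s : 'S_n) : exc s = (\sum_(i < n) (i < s i))%N.
Proof.
rewrite /exc -sum1_count -{1}[1%N]/(1 + 0)%N iotaDl big_map big_mkcond.
rewrite -val_enum_ord big_map big_enum /=.
by apply: eq_bigr => i _; rewrite add1n letterE ltnS; case: ltnP.
Qed.

(* The excedances of [lift_perm ord0 j s] at positions other than the first. *)
Definition shifted_exc (n : nat) (j : nat) (s : 'S_n) : nat :=
  (\sum_(i < n) (i.+1 < bump j (s i)))%N.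

Lemma shifted_exc0 (n : nat) (s : 'S_n) : shifted_exc 0 s = exc s.
Proof. by rewrite excE; apply: eq_bigr => i _; rewrite /bump add1n. Qed.

(** Only the value 0 escapes the shift, and it is an excedance on neither side. *)
Lemma shifted_exc1 (n : nat) (s : 'S_n) : shifted_exc 1 s = exc s.
Proof. by rewrite excE; apply: eq_bigr => i _; rewrite /bump; lia. Qed.

Lemma AExc_firstE (n : nat) (j : 'I_n.+1) :
  AExc_first n.+1 j.+1
    = 'X^(0 < j)%N * \sum_(s : 'S_n) 'X^(shifted_exc j s).
Proof.
rewrite /AExc_first sum_perms_starting mulr_sumr; apply: eq_bigr => s _.
rewrite -exprD excE big_ord_recl lift_perm_id; congr ('X^(_ + _)).
by apply: eq_bigr => i _; rewrite lift_perm_lift.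
Qed.

Lemma AExc_first1 (n : nat) : AExc_first n.+1 1 = \sum_(s : 'S_n) 'X^(exc s).
Proof.
rewrite (AExc_firstE ord0) mul1r.
by apply: eq_bigr => s _; rewrite shifted_exc0.
Qed.

Lemma AExc_first2 (n : nat) :
  AExc_first n.+2 2 = 'X * \sum_(s : 'S_n.+1) 'X^(exc s).
Proof.
rewrite (AExc_firstE (lift ord0 ord0)) expr1; congr (_ * _).
by apply: eq_bigr => s _; rewrite shifted_exc1.
Qed.

(* Moving the gap from [j] past it only affects the preimage of [j], whose
   shifted excedance is lost exactly when that preimage is [i = j - 1]. *)
Lemma shifted_exc_step (n : nat) (i j : 'I_n) (s : 'S_n) : j = i.+1 :> nat ->
  shifted_exc j s = ((s i == j) + shifted_exc j.+1 s)%N.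
Proof.
move=> ji; rewrite /shifted_exc (bigD1 i) //= [in RHS](bigD1 i) //= addnA.
congr (_ + _)%N; first by rewrite -val_eqE /= /bump; lia.
apply: eq_bigr => k; rewrite -val_eqE /= => /eqP ki; rewrite /bump; lia.
Qed.

(** The arrow from [i] to [j] counts for nothing, as the gap [j.+1] leaves [j] equal to [i.+1].
    Removing it lowers later positions and larger values together; when only one of the two moves,
    the comparison keeps its outcome. *)
Lemma shifted_exc_contract (n : nat) (i j : 'I_n.+1) (s : 'S_n) :
  j = i.+1 :> nat -> shifted_exc j.+1 (lift_perm i j s) = shifted_exc j s.
Proof.
move=> ji; rewrite /shifted_exc (bigD1_ord i) //= lift_perm_id.
rewrite -[RHS]add0n; congr (_ + _)%N; first by rewrite /bump ltnn ji ltnn.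
apply: eq_bigr => k _; rewrite lift_perm_lift /= /bump.
by case: (leqP j (s k)) => jsk; case: (leqP i k) => ik; lia.
Qed.

Lemma AExc_first_step (n j : nat) : (j < n)%N ->
  AExc_first n.+2 j.+2 - AExc_first n.+2 j.+3
    = ('X - 1) * AExc_first n.+1 j.+2.
Proof.
move=> lt_jn; have lt_j : (j < n.+1)%N by lia.
rewrite (@AExc_firstE _ (Ordinal (_ : j.+1 < n.+2)%N)) //.
rewrite (@AExc_firstE _ (Ordinal (_ : j.+2 < n.+2)%N)) //.
rewrite (@AExc_firstE _ (Ordinal (_ : j.+1 < n.+1)%N)) //= !expr1.
pose i : 'I_n.+1 := Ordinal lt_j; pose k : 'I_n.+1 := @Ordinal n.+1 j.+1 lt_jn.
rewrite -mulrBr -sumrB mulrCA; congr (_ * _).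
(* Undoing the contraction makes the right-hand sum run over the [s] with [s i = k], exactly those
   whose two terms on the left differ, by a factor ['X]. *)
under [in RHS]eq_bigr => s _ do
  rewrite -(@shifted_exc_contract n i k s erefl).
rewrite -(sum_perm_lift i k (fun s => 'X^(shifted_exc k.+1 s))).
rewrite mulr_sumr [RHS]big_mkcond; apply: eq_bigr => s _.
rewrite (@shifted_exc_step _ i k s erefl) /=; case: eqP => _ /=.
  by rewrite exprS; ring.
by rewrite subrr.
Qed.

Lemma A_recl (n : nat) :
  A n.+1 = A_first n.+1 1 + \sum_(j < n) A_first n.+1 j.+2.
Proof. by rewrite /A sum_by_first_letter big_ord_recl. Qed.

Lemma AExc_recl (n : nat) :
  \sum_(s : 'S_n.+1) 'X^(exc s)
    = AExc_first n.+1 1 + \sum_(j < n) AExc_first n.+1 j.+2.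
Proof. by rewrite sum_by_first_letter big_ord_recl. Qed.

Lemma des_exc_equidistributed1 : A 1 = \sum_(s : 'S_1) 'X^(exc s).
Proof.
apply: eq_bigr => s _; rewrite excE big1 // => i _.
by rewrite (ord1 (s i)).
Qed.

(** The sizes are staggered: summing the second claim over [j] gives the first at the next [n],
    which in turn starts the second there. *)
Lemma A_first_AExc_first (n : nat) :
  A n.+1 = \sum_(s : 'S_n.+1) 'X^(exc s) /\
  forall j, (j <= n)%N -> A_first n.+2 j.+2 = AExc_first n.+2 (n.+2 - j).
Proof.
elim: n => [|n [IHA IHj]].
  split=> [|j]; first exact: des_exc_equidistributed1.
  rewrite leqn0 => /eqP->.
  by rewrite A_first_max AExc_first2 des_exc_equidistributed1.
have eqA : A n.+2 = \sum_(s : 'S_n.+2) 'X^(exc s).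
  rewrite A_recl AExc_recl A_first1 AExc_first1 IHA; congr (_ + _).
  rewrite [RHS](reindex_inj rev_ord_inj); apply: eq_bigr => j _ /=.
  by rewrite (IHj _ (leq_ord _)); congr AExc_first; have := ltn_ord j; lia.
split=> // j le_jn; rewrite -(subKn le_jn).
(* Descend from the largest first letter, where both sides are ['X] times a total already known to
   agree. *)
elim: (n.+1 - j)%N (leq_subr j n.+1) => [_|d IHd lt_dn].
  by rewrite subn0 A_first_max [(_ - _)%N](_ : _ = 2%N) ?AExc_first2 ?eqA //; lia.
have /IHd {}IHd : (d <= n.+1)%N by lia.
have le_d : ((n.+1 - d.+1).+1 <= n.+1)%N by lia.
have eq_d : (n.+1 - d = (n.+1 - d.+1).+1)%N by lia.
have stepA := A_first_step le_d.
have stepE := @AExc_first_step n.+1 d lt_dn.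
rewrite eq_d in IHd.
(* Now both recurrences have the same right-hand side, and by [IHd] the same leading term, which
   cancels. *)
rewrite IHj in stepA; last by lia.
have e1 : (n.+3 - (n.+1 - d.+1).+1 = d.+2)%N by lia.
have e2 : (n.+3 - (n.+1 - d.+1) = d.+3)%N by lia.
have e3 : (n.+2 - (n.+1 - d.+1) = d.+2)%N by lia.
rewrite e1 in IHd; rewrite e3 IHd -stepE in stepA; rewrite e2.
by move/addrI/oppr_inj: stepA.
Qed.

Theorem corollary2 (n : nat) (hn : (2 <= n)%N) :
  [/\ A_first n 1 = AExc_first n 1 /\ AExc_first n 1 = A (n - 1)%N,
      forall j : nat, (2 <= j <= n)%N ->
        A_first n j = AExc_first n (n + 2 - j)%N
    & exists p : 'S_n, forall i : 'I_n,
        A_first n i.+1 = AExc_first n (p i).+1].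
Proof.
case: n hn => [|[|n]] // _; have [eqA eqj] := A_first_AExc_first n.
have eq1 : A_first n.+2 1 = AExc_first n.+2 1.
  by rewrite A_first1 AExc_first1.
split=> [|[|[|j]] // /andP[_ le_jn]|].
- by split=> //; rewrite -eq1 A_first1 subn1.
- by rewrite eqj //; congr AExc_first; lia.
(* Fix the first index and reverse the others: 1-based, this is [j] to [n + 2 - j] for [j] at least
   2, at the original size [n]. *)
exists (lift_perm ord0 ord0 (perm (@rev_ord_inj n.+1))) => i.
case: (unliftP ord0 i) => [k|] ->; last by rewrite lift_perm_id.
rewrite lift_perm_lift permE /= /bump !add1n (eqj _ (leq_ord _)).
by congr AExc_first; rewrite subSS !subSn ?leqW ?leq_ord.
Qed.
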